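(* Let $\widetilde\Lambda_b$ be the bounded feasible set with diameter $D\in(0,\infty)$, and assume that the solution set $Y^d$ of the dual (Minty) problem on $\widetilde\Lambda_b$ is non-empty. Let $a>0$ and let $\{X^k\}_{k\ge0}\subset\widetilde\Lambda_b$ be a sequence generated by the proximal point method with parameter $a$, i.e. $X^0\in\widetilde\Lambda_b$ and, for every $k\ge0$, $$\langle\mathcal{F}(X^{k+1})+a(X^{k+1}-X^k),\,X-X^{k+1}\rangle_E\ge0\qquad\forall X\in\widetilde\Lambda_b .$$ For $k\ge0$ let $\mu(k)=\operatorname{argmin}_{0\le i\le k}\|X^i-X^{i+1}\|_E^2\in\{0,\dots,k\}$. Then for any tolerance $\delta>0$, with $R=\lceil a^2D^4/\delta^2\rceil-1$, $$\langle\mathcal{F}(X^{\mu(R)+1}),\,X-X^{\mu(R)+1}\rangle_E\ge-\delta\qquad\forall X\in\widetilde\Lambda_b .$$ Moreover, when the algorithm terminates, i.e. at the first $k$ for which $\|X^{k+1}-X^k\|_E\le\frac{\delta}{aD}$, $$\langle\mathcal{F}(X^{k+1}),\,X-X^{k+1}\rangle_E\ge-\delta\qquad\forall X\in\widetilde\Lambda_b .$$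
   Context: Fix a time interval $[t_0,t_f]$ with $t_0<t_f$, a finite set $\mathcal{W}$ of origin-destination (O-D) pairs, and a finite set $\mathcal{P}$ of paths which is the disjoint union of the sets $\mathcal{P}_{ij}$ of paths connecting O-D pair $(i,j)\in\mathcal{W}$. The effective path delay operator is a given map $\Psi:(L^2_+[t_0,t_f])^{|\mathcal{P}|}\to(L^2_+[t_0,t_f])^{|\mathcal{P}|}$ ($L^2_+$: nonnegative functions in $L^2$), and the inverse demand function is a given map $\Theta:\mathbb{R}_+^{|\mathcal{W}|}\to\mathbb{R}_{++}^{|\mathcal{W}|}$. $E=(L^2[t_0,t_f])^{|\mathcal{P}|}\times\mathbb{R}^{|\mathcal{W}|}$ is the Hilbert space with inner product $\langle(\xi,u),(\eta,v)\rangle_E=\sum_{p\in\mathcal{P}}\int_{t_0}^{t_f}\xi_p(t)\eta_p(t)\,dt+\sum_{(i,j)\in\mathcal{W}}u_{ij}v_{ij}$ and induced norm $\|\cdot\|_E$. Let $$\widetilde\Lambda=\Big\{(h,Q)\in E:\ h\ge 0,\ \sum_{p\in\mathcal{P}_{ij}}\int_{t_0}^{t_f}h_p(t)\,dt=Q_{ij}\ \ \forall (i,j)\in\mathcal{W}\Big\},$$ and $\mathcal{F}:\widetilde\Lambda\to E$, $\mathcal{F}(h,Q)=(\Psi(h),-\Theta[Q])$. The bounded feasible set $\widetilde\Lambda_b$ is a non-empty, closed, convex, bounded subset of $\widetilde\Lambda$ (the feasible set as used in computation). The dual (Minty) problem on $\widetilde\Lambda_b$ is to find $X^d\in\widetilde\Lambda_b$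 such that $\langle\mathcal{F}(X),X-X^d\rangle_E\ge0$ for all $X\in\widetilde\Lambda_b$; its solution set is denoted $Y^d$. $\lceil z\rceil$ is the smallest integer larger than or equal to $z$. *)

(* Defs.v *)
From HB Require Import structures.
From mathcomp Require Import all_boot all_order all_algebra.
From mathcomp Require Import all_classical all_reals all_analysis measurable_realfun.
From mathcomp Require Import ring lra.
Set Implicit Arguments.
Unset Strict Implicit.
Unset Printing Implicit Defensive.
Import Order.TTheory GRing.Theory Num.Theory.
Import numFieldNormedType.Exports.
Local Open Scope classical_set_scope.
Local Open Scope ring_scope.

(* The library's L^2 space [LspaceType2 mu] (a.e.-classes) carries no algebraic
   structure; [L2 mu] equips it with its vector space structure. An element
   [f : L2 mu] coerces to a function through a chosen representative, and only
   expressions invariant under a.e. equality are formed from it. *)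
Section L2_space.
Context d (T : measurableType d) (R : realType).
Variable mu : {measure set T -> \bar R}.

Definition L2 : Type := LspaceType2 mu.

HB.instance Definition _ := gen_eqMixin L2.
HB.instance Definition _ := gen_choiceMixin L2.

Local Notation Lf := (Lfun mu (2%:R)%:E).
Local Notation fn := (fun f : L2 => (f : T -> R)).

Lemma L2_Lfun (f : L2) : fn f \in Lf.
Proof.
apply/andP; split; rewrite inE /=; last exact: (@Lebesgue_finite _ _ _ _ _ _ f).
exact: (@measurable_funPT _ _ _ (measurableTypeR R) (repr (LebesgueSpace.sort f))).
Qed.

Lemma L2_ae_eq (f g : L2) : fn f = fn g %[ae mu] -> f = g.
Proof.
move=> fg.
have /eqP E : LebesgueSpace.sort f == LebesgueSpace.sort g.
  move: (introT (ae_eqP (LebesgueSpace.sort f) (LebesgueSpace.sort g)) fg).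
  by rewrite !reprK.
move: fg; case: f g E => [f [[pf]]] [g [[pg]]] /= E _.
by subst g; rewrite (Prop_irrelevance pf pg).
Qed.

Lemma Lfun_L2 (f : T -> R) : f \in Lf -> {F : L2 | fn F = f %[ae mu]}.
Proof.
move=> hf.
pose mf : {mfun T >-> measurableTypeR R} :=
  HB.pack f (@isMeasurableFun.Build _ _ T (measurableTypeR R) f
               (set_mem (sub_Lfun_mfun hf))).
pose qf : {mfun_ mu, T >-> measurableTypeR R} := (\pi mf)%qT.
have qfE : (qf : T -> R) = f %[ae mu].
  have /eqmodP/asboolP // :
    (repr qf = mf %[mod {mfun_ mu, T >-> measurableTypeR R}])%qT.
  by rewrite reprK.
have fin : finite_norm mu (2%:R)%:E (qf : T -> R).
  have := set_mem (sub_Lfun_finLfun hf); rewrite /= /finite_norm unlock /Lnorm.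
  have m (g : T -> R) : measurable_fun setT g ->
      measurable_fun setT (fun x => `|(EFin \o g) x| `^ 2)%E.
    move=> mg; apply: (measurableT_comp (measurable_poweR _)).
    by apply: measurableT_comp => //; exact/measurable_EFinP.
  rewrite (@ge0_ae_eq_integral _ _ _ mu setT _
    (fun x => `|(EFin \o (qf : T -> R)) x| `^ 2)%E) //.
  - exact/m/(set_mem (sub_Lfun_mfun hf)).
  - exact/m/(@measurable_funPT _ _ _ (measurableTypeR R) (repr qf)).
  - by move=> x _; exact: poweR_ge0.
  - by move=> x _; exact: poweR_ge0.
  - by apply: filterS qfE => x /= + _ => ->.
by exists (LebesgueSpace.pack_ (isFinLebesgue.Build _ _ _ _ _ (lee1n 2) qf fin)).
Qed.


Let p1 : (1 <= (2%:R)%:E :> \bar R)%E := lee1n 2.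

Let Lf0 : (0 : T -> R) \in Lf. Proof. exact: (Lfun_addr_closed mu p1).1. Qed.
Let LfD (f g : L2) : (fn f + fn g : T -> R) \in Lf.
Proof. exact: (Lfun_addr_closed mu p1).2 _ _ (L2_Lfun f) (L2_Lfun g). Qed.
Let LfN (f : L2) : (- fn f : T -> R) \in Lf.
Proof. exact: Lfun_oppr_closed (L2_Lfun f). Qed.
Let LfZ a (f : L2) : (a *: fn f : T -> R) \in Lf.
Proof.
have := (Lfun_submod_closed mu p1).2 a _ _ (L2_Lfun f) Lf0.
by rewrite addr0.
Qed.

Definition L2_zero : L2 := sval (Lfun_L2 Lf0).
Definition L2_add (f g : L2) : L2 := sval (Lfun_L2 (LfD f g)).
Definition L2_opp (f : L2) : L2 := sval (Lfun_L2 (LfN f)).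
Definition L2_scale (a : R) (f : L2) : L2 := sval (Lfun_L2 (LfZ a f)).

Let zeroE : {ae mu, forall t, fn L2_zero t = 0}.
Proof. by apply: filterS (svalP (Lfun_L2 Lf0)) => t; exact. Qed.
Let addE f g : {ae mu, forall t, fn (L2_add f g) t = fn f t + fn g t}.
Proof. by apply: filterS (svalP (Lfun_L2 (LfD f g))) => t; exact. Qed.
Let oppE f : {ae mu, forall t, fn (L2_opp f) t = - fn f t}.
Proof. by apply: filterS (svalP (Lfun_L2 (LfN f))) => t; exact. Qed.
Let scaleE a f : {ae mu, forall t, fn (L2_scale a f) t = a * fn f t}.
Proof. by apply: filterS (svalP (Lfun_L2 (LfZ a f))) => t; exact. Qed.

Let L2_ae f g : {ae mu, forall t, fn f t = fn g t} -> f = g.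
Proof. by move=> fg; apply: L2_ae_eq; apply: filterS fg => t. Qed.

Let addA : associative L2_add.
Proof.
move=> f g h; apply: L2_ae; near=> t.
transitivity (fn f t + (fn g t + fn h t)).
  transitivity (fn f t + fn (L2_add g h) t); last congr (_ + _); near: t; exact: addE.
rewrite addrA; apply/esym; transitivity (fn (L2_add f g) t + fn h t).
  by near: t; exact: addE.
by congr (_ + _); near: t; exact: addE.
Unshelve. all: by end_near. Qed.

Let addC : commutative L2_add.
Proof.
move=> f g; apply: L2_ae.
by apply: filterS2 (addE f g) (addE g f) => t -> ->; exact: addrC.
Qed.

Let add0 : left_id L2_zero L2_add.
Proof.
move=> f; apply: L2_ae.
by apply: filterS2 (addE L2_zero f) zeroE => t -> ->; exact: add0r.
Qed.

Let addN : left_inverse L2_zero L2_opp L2_add.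
Proof.
move=> f; apply: L2_ae.
by apply: filterS3 (addE (L2_opp f) f) (oppE f) zeroE => t -> -> ->; exact: addNr.
Qed.

HB.instance Definition _ := GRing.isZmodule.Build L2 addA addC add0 addN.

Let scaleA a b f : L2_scale a (L2_scale b f) = L2_scale (a * b) f.
Proof.
apply: L2_ae; apply: filterS3 (scaleE a (L2_scale b f)) (scaleE b f) (scaleE (a * b) f).
by move=> t -> -> ->; rewrite mulrA.
Qed.

Let scale1 : left_id 1 L2_scale.
Proof. by move=> f; apply: L2_ae; apply: filterS (scaleE 1 f) => t ->; rewrite mul1r. Qed.

Let scaleDr : right_distributive L2_scale +%R.
Proof.
move=> a f g; apply: L2_ae.
apply: filterS3 (scaleE a (f + g)) (addE (L2_scale a f) (L2_scale a g))
  (filterI (scaleE a f) (filterI (scaleE a g) (addE f g))).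
by move=> t -> -> [-> [-> ->]]; rewrite mulrDr.
Qed.

Let scaleDl f : {morph L2_scale^~ f : a b / a + b}.
Proof.
move=> a b; apply: L2_ae.
apply: filterS3 (scaleE (a + b) f) (addE (L2_scale a f) (L2_scale b f))
  (filterI (scaleE a f) (scaleE b f)).
by move=> t -> -> [-> ->]; rewrite mulrDl.
Qed.

HB.instance Definition _ :=
  GRing.Zmodule_isLmodule.Build R L2 scaleA scale1 scaleDr scaleDl.

Lemma L2_addE (f g : L2) : {ae mu, forall t, fn (f + g) t = fn f t + fn g t}.
Proof. exact: addE. Qed.

Lemma L2_scaleE a (f : L2) : {ae mu, forall t, fn (a *: f) t = a * fn f t}.
Proof. exact: scaleE. Qed.

(* [\int[mu]_t _] is the real-valued integral; [L2_dot_integrable] shows that it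
   is never used at a non-integrable argument here. *)
Definition L2_dot (f g : L2) : R := \int[mu]_t (f t * g t).

Lemma L2_dot_integrable (f g : L2) :
  mu.-integrable setT (EFin \o (fun t => f t * g t)).
Proof. by apply/Lfun1_integrable/Lfun2_mul_Lfun1; exact: L2_Lfun. Qed.

Lemma L2_dotC f g : L2_dot f g = L2_dot g f.
Proof. by apply: eq_Rintegral => t _; rewrite mulrC. Qed.

Let ae_Rintegral (u v : T -> R) : measurable_fun setT u -> measurable_fun setT v ->
  {ae mu, forall t, u t = v t} -> \int[mu]_t u t = \int[mu]_t v t.
Proof.
move=> mu_ mv uv; rewrite /Rintegral; congr fine.
apply: ae_eq_integral => //; [exact/measurable_EFinP|exact/measurable_EFinP|].
by apply: filterS uv => t /= ->.
Qed.

Let meas (f : L2) : measurable_fun setT (fn f).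
Proof. exact: set_mem (sub_Lfun_mfun (L2_Lfun f)). Qed.

Lemma L2_dotDl f g h : L2_dot (f + g) h = L2_dot f h + L2_dot g h.
Proof.
rewrite /L2_dot -RintegralD//; [|exact: L2_dot_integrable..].
apply: ae_Rintegral; [exact: measurable_funM|apply: measurable_funD; exact: measurable_funM|].
by apply: filterS (L2_addE f g) => t ->; rewrite mulrDl.
Qed.

Lemma L2_dotZl a f h : L2_dot (a *: f) h = a * L2_dot f h.
Proof.
rewrite /L2_dot -RintegralZl//; [|exact: L2_dot_integrable].
apply: ae_Rintegral; [exact: measurable_funM|apply: measurable_funM => //; exact: measurable_funM|].
by apply: filterS (L2_scaleE a f) => t ->; rewrite mulrA.
Qed.

Lemma L2_dot_ge0 f : 0 <= L2_dot f f.
Proof. by apply: Rintegral_ge0 => t _; rewrite -expr2 sqr_ge0. Qed.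

Lemma L2_dot_eq0 f : L2_dot f f = 0 -> f = 0.
Proof.
move=> ff0; apply: L2_ae.
have i := L2_dot_integrable f f.
have : (\int[mu]_t `|(f t * f t)%:E| = 0)%E.
  rewrite -[RHS]/(0%:E) -ff0 /L2_dot /Rintegral fineK.
    by apply: eq_integral => t _; rewrite gee0_abs// lee_fin -expr2 sqr_ge0.
  exact: integrable_fin_num.
move/(ae_eq_integral_abs mu measurableT (measurable_int _ i)).
apply: filterS2 zeroE => t /= -> /(_ I)[] /eqP.
by rewrite mulf_eq0 orbb => /eqP.
Qed.

End L2_space.

Section hilbert.
Context d (T : measurableType d) (R : realType).
Variables (mu : {measure set T -> \bar R}) (P W : finType).

(* A fresh name for the product, so that the norm below is the one induced by
   the inner product and not the library's maximum norm on pairs. [R^o] is [R]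
   as a vector space over itself. *)
Definition hspace : Type := ({ffun P -> L2 mu} * {ffun W -> R^o})%type.

HB.instance Definition _ :=
  GRing.Lmodule.copy hspace ({ffun P -> L2 mu} * {ffun W -> R^o})%type.

Definition dot (X Y : hspace) : R :=
  \sum_p L2_dot (X.1 p) (Y.1 p) + \sum_w X.2 w * Y.2 w.

Lemma dotC X Y : dot X Y = dot Y X.
Proof.
by rewrite /dot; congr (_ + _); apply: eq_bigr => i _; rewrite (L2_dotC, mulrC).
Qed.

Lemma dotDl X Y Z : dot (X + Y) Z = dot X Z + dot Y Z.
Proof.
rewrite /dot addrACA -!big_split /=; congr (_ + _); apply: eq_bigr => i _.
  by rewrite ffunE L2_dotDl.
by rewrite ffunE mulrDl.
Qed.

Lemma dotZl a X Y : dot (a *: X) Y = a * dot X Y.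
Proof.
rewrite /dot mulrDr !mulr_sumr; congr (_ + _); apply: eq_bigr => i _.
  by rewrite ffunE L2_dotZl.
by rewrite ffunE -mulrA.
Qed.

Lemma dot_ge0 X : 0 <= dot X X.
Proof.
apply: addr_ge0; apply: sumr_ge0 => i _; first exact: L2_dot_ge0.
by rewrite -expr2 sqr_ge0.
Qed.

Lemma dot_eq0 X : dot X X = 0 -> X = 0.
Proof.
have P0 : 0 <= \sum_p L2_dot (X.1 p) (X.1 p) by apply: sumr_ge0 => i _; exact: L2_dot_ge0.
have W0 : 0 <= \sum_w X.2 w * X.2 w by apply: sumr_ge0 => i _; rewrite -expr2 sqr_ge0.
move=> /eqP; rewrite paddr_eq0// => /andP[/eqP x /eqP y].
rewrite [X]surjective_pairing; congr (_, _); apply/ffunP => i; rewrite ffunE.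
  by apply: L2_dot_eq0; apply: (psumr_eq0P _ x) => // j _; exact: L2_dot_ge0.
apply/eqP; rewrite -[_ == 0]orbb -mulf_eq0; apply/eqP.
by apply: (psumr_eq0P _ y) => // j _; rewrite -expr2 sqr_ge0.
Qed.

Definition hnorm (X : hspace) : R := Num.sqrt (dot X X).

Lemma dot_le_norm X Y : dot X Y <= hnorm X * hnorm Y.
Proof.
have dotDr (A B C : hspace) : dot A (B + C) = dot A B + dot A C.
  by rewrite dotC dotDl !(dotC A).
have dotZr a (A B : hspace) : dot A (a *: B) = a * dot A B.
  by rewrite dotC dotZl (dotC A).
have x0 := dot_ge0 X; have y0 := dot_ge0 Y.
rewrite /hnorm -sqrtrM// (le_trans (ler_norm _))// -sqrtr_sqr ler_wsqrtr//.
have [Y0|Yn0] := eqVneq (dot Y Y) 0.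
  rewrite (dot_eq0 Y0) -(scale0r Y) !dotZr !mul0r mulr0 expr0n //=.
have Yp : 0 < dot Y Y by rewrite lt_neqAle eq_sym Yn0.
have := dot_ge0 (dot Y Y *: X - dot X Y *: Y).
rewrite -scaleNr !(dotDl, dotDr, dotZl, dotZr) (dotC Y X).
set xx := dot X X; set yy := dot Y Y; set xy := dot X Y => h.
have {h} : 0 <= yy * (xx * yy - xy ^+ 2) by apply: le_trans h _; rewrite le_eqVlt; apply/orP; left; apply/eqP; ring.
by rewrite pmulr_rge0// subr_ge0.
Qed.

Let hnormD X Y : hnorm (X + Y) <= hnorm X + hnorm Y.
Proof.
rewrite -(@ler_pXn2r _ 2) ?nnegrE ?addr_ge0 ?sqrtr_ge0//.
rewrite sqrrD !sqr_sqrtr ?dot_ge0// dotDl !(dotC _ (X + Y)) !dotDl (dotC Y X).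
have := dot_le_norm X Y; lra.
Qed.

Let hnormZ a X : hnorm (a *: X) = `|a| * hnorm X.
Proof.
rewrite /hnorm dotZl dotC dotZl mulrA -expr2 sqrtrM ?sqr_ge0//.
by rewrite sqrtr_sqr.
Qed.

Let hnorm_eq0 X : hnorm X = 0 -> X = 0.
Proof. by move=> /eqP; rewrite sqrtr_eq0 => h; apply: dot_eq0; apply/eqP; rewrite eq_le h dot_ge0. Qed.

HB.instance Definition _ :=
  Lmodule_isNormed.Build R hspace hnormD hnormZ hnorm_eq0.

Lemma hnormE X : `|X| = Num.sqrt (dot X X). Proof. by []. Qed.
End hilbert.

Section traffic.
Context (R : realType).

(* Lebesgue measure on [t0, tf], as a measure on R that ignores the complement
   of [t0, tf]; hence [\int[leb_itv t0 tf]_t f t] is the integral of [f] over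
   [t0, tf], and "a.e." means a.e. on [t0, tf]. *)
Definition leb_itv (t0 tf : R) :=
  mrestr (@lebesgue_measure R) (measurable_itv `[t0, tf]).

HB.instance Definition _ (t0 tf : R) := Measure.on (leb_itv t0 tf).

Variables (t0 tf : R) (P W : finType).
Local Notation mu := (leb_itv t0 tf).

Definition flow := {ffun P -> L2 mu}.
Definition demand := {ffun W -> R^o}.
Definition espace := hspace mu P W.

HB.instance Definition _ := NormedModule.copy espace (hspace mu P W).

Implicit Types (h : flow) (X : espace) (A : set espace).

Definition flow_nonneg h := forall p, {ae mu, forall t, 0 <= h p t}.

(* [od p] is the O-D pair connected by the path [p], so that
   [P_w = [set p | od p == w]]. *)
Definition feasible (od : P -> W) : set espace :=
  [set X : espace | flow_nonneg X.1 /\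
    forall w : W, (\sum_(p | od p == w) \int[mu]_t X.1 p t) = X.2 w].

(* Maps on the nonnegative cone are encoded as total functions that are
   constrained only there; their values elsewhere are irrelevant. *)
Definition delay_operator (Psi : flow -> flow) :=
  forall h, flow_nonneg h -> flow_nonneg (Psi h).

Definition inverse_demand (Theta : demand -> demand) :=
  forall Q : demand, (forall w, 0 <= Q w) -> forall w, 0 < Theta Q w.

Definition vi_map (Psi : flow -> flow) (Theta : demand -> demand) X : espace :=
  (Psi X.1, - Theta X.2).

Definition minty_solutions (F : espace -> espace) A : set espace :=
  [set Xd : espace | A Xd /\ forall X, A X -> 0 <= dot (F X) (X - Xd)].

Definition proximal_sequence (F : espace -> espace) A (a : R)
    (x : nat -> espace) :=
  (forall k, A (x k)) /\
  forall k X, A X ->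
    0 <= dot (F (x k.+1) + a *: (x k.+1 - x k)) (X - x k.+1).

(* Used only for nonempty bounded sets, where the supremum exists. *)
Definition diameter A : R := sup [set `|X - Y| | X in A & Y in A].

End traffic.

Definition argmin_upto (R : realType) (u : nat -> R) (k i : nat) :=
  (i <= k)%N /\ forall j, (j <= k)%N -> u i <= u j.

(* Main.v *)
Require Import Defs.
From mathcomp Require Import all_boot all_order all_algebra.
From mathcomp Require Import all_classical all_reals all_analysis.
From mathcomp Require Import ring lra.
Set Implicit Arguments.
Unset Strict Implicit.
Import Order.TTheory GRing.Theory Num.Theory.
Import numFieldNormedType.Exports.
Local Open Scope classical_set_scope.
Local Open Scope ring_scope.

(** Write [d k = X k.+1 - X k] for the proximal steps.  The proximal inequality
bounds the gap [dot (F (X k.+1)) (Y - X k.+1)] from below by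
[- a * dot (d k) (Y - X k.+1)], hence, by Cauchy-Schwarz and the definition of
the diameter [D], by [- a * `|d k| * D].  So a step of length at most
[delta / (a * D)] yields a [delta]-approximate solution
([gap_of_small_step]); this alone settles the terminating iterate.

It remains to see that one of the first [N + 1] steps is that short.  Test the
proximal inequality at a Minty solution [Z]: the Minty inequality cancels the
operator and leaves [0 <= dot (d k) (Z - X k.+1)], i.e. the angle at [X k.+1]
between [X k] and [Z] is not acute.  By the law of cosines the squared distance to
[Z] drops by at least [`|d k| ^+ 2] at step [k] ([prox_fejer]).  These drops
telescope, so the squared steps sum to at most [D ^+ 2]
([sum_steps_le_diameter]) and the smallest of the first [n] of them is at most
[D ^+ 2 / n].  With [n = N + 1 >= a ^+ 2 * D ^+ 4 / delta ^+ 2] this is at most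
[(delta / (a * D)) ^+ 2]. *)

Section inner_product.
Context (R : realType) (t0 tf : R) (P W : finType).
Implicit Types (X Y Z : espace t0 tf P W) (A : set (espace t0 tf P W)).

Lemma dotNl X Y : dot (- X) Y = - dot X Y.
Proof. by rewrite -scaleN1r dotZl mulN1r. Qed.

Lemma dotDr X Y Z : dot X (Y + Z) = dot X Y + dot X Z.
Proof. by rewrite dotC dotDl !(dotC X). Qed.

Lemma dotNr X Y : dot X (- Y) = - dot X Y.
Proof. by rewrite dotC dotNl dotC. Qed.

Lemma sqr_normE X : `|X| ^+ 2 = dot X X.
Proof. by rewrite hnormE sqr_sqrtr// dot_ge0. Qed.

Lemma dot_le_normM X Y : dot X Y <= `|X| * `|Y|.
Proof. exact: dot_le_norm. Qed.

Lemma law_of_cosines X Y Z :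
  `|X - Z| ^+ 2 =
    `|Y - Z| ^+ 2 + `|Y - X| ^+ 2 + dot (Y - X) (Z - Y) *+ 2.
Proof.
rewrite !sqr_normE !(dotDl, dotDr, dotNl, dotNr).
by rewrite (dotC Z X) (dotC Y X) (dotC Z Y); ring.
Qed.

(** Boundedness is what makes the supremum in [diameter] an upper bound. *)
Lemma dist_le_diameter A X Y :
  bounded_set A -> A X -> A Y -> `|X - Y| <= diameter A.
Proof.
move=> [M [_ bA]] AX AY.
have {}bA Z : A Z -> `|Z| <= M + 1 by apply: (bA (M + 1)); rewrite ltrDl.
apply: ub_le_sup; last by exists X => //; exists Y.
exists ((M + 1) + (M + 1)) => _ [U AU [V AV <-]].
by rewrite (le_trans (ler_normB _ _))// lerD// bA.
Qed.

End inner_product.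

Section proximal.
Context (R : realType) (t0 tf : R) (P W : finType).
Variables (F : espace t0 tf P W -> espace t0 tf P W).
Variables (A : set (espace t0 tf P W)) (a : R).
Variable X : nat -> espace t0 tf P W.
Hypotheses (a_gt0 : 0 < a) (A_bounded : bounded_set A).
Hypothesis X_prox : proximal_sequence F A a X.

(** The proximal inequality is the variational inequality at [X k.+1] up to the
extra term [a *: (X k.+1 - X k)], whose effect is at most [a * `|step| * D]. *)
Lemma gap_of_small_step k delta Y : 0 < diameter A ->
    `|X k.+1 - X k| <= delta / (a * diameter A) -> A Y ->
  - delta <= dot (F (X k.+1)) (Y - X k.+1).
Proof.
move=> D_gt0 step AY; have [AX prox] := X_prox.
have := prox k Y AY; rewrite dotDl dotZl -lerBlDr sub0r; apply: le_trans.
rewrite lerN2.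
have -> : delta = a * (delta / (a * diameter A) * diameter A).
  by field; rewrite !gt_eqF.
rewrite ler_pM2l// (le_trans (dot_le_normM _ _))// ler_pM//.
exact: dist_le_diameter.
Qed.

(** Fejer monotonicity with respect to Minty solutions, in quantitative form. *)
Lemma prox_fejer Z k : minty_solutions F A Z ->
  `|X k.+1 - Z| ^+ 2 + `|X k.+1 - X k| ^+ 2 <= `|X k - Z| ^+ 2.
Proof.
move=> [AZ minty]; have [AX prox] := X_prox.
rewrite (law_of_cosines (X k) (X k.+1) Z) lerDl mulrn_wge0//.
rewrite -(pmulr_rge0 _ a_gt0).
have := minty _ (AX k.+1); have := prox k Z AZ.
by rewrite dotDl dotZl -(opprB Z) dotNr; lra.
Qed.

Lemma sum_steps_le_diameter Z n : minty_solutions F A Z ->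
  \sum_(i < n) `|X i - X i.+1| ^+ 2 <= diameter A ^+ 2.
Proof.
move=> YZ; have [AX _] := X_prox.
have sumE : \sum_(i < n) `|X i - X i.+1| ^+ 2 + `|X n - Z| ^+ 2
            <= `|X 0%N - Z| ^+ 2.
  elim: n => [|n IHn]; first by rewrite big_ord0 add0r.
  rewrite big_ord_recr /= (distrC (X n)).
  by have := prox_fejer n YZ; lra.
have X0Z : `|X 0%N - Z| ^+ 2 <= diameter A ^+ 2.
  have X0ZD := dist_le_diameter A_bounded (AX 0%N) YZ.1.
  by rewrite lerXn2r ?nnegrE ?(le_trans _ X0ZD).
have := sqr_ge0 `|X n - Z|; lra.
Qed.

End proximal.

Lemma argmin_upto_le_mean (R : realType) (u : nat -> R) (k i : nat) :
  argmin_upto u k i -> k.+1%:R * u i <= \sum_(j < k.+1) u j.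
Proof.
move=> [_ umin]; rewrite mulr_natl -[X in _ *+ X]card_ord -sumr_const.
by apply: ler_sum => j _; apply: umin; rewrite -ltnS.
Qed.

(** Positivity of [x] gives [1 <= ceil x], so the absolute value that turns
[ceil x - 1] into a natural number is harmless. *)
Lemma le_succ_absz_ceil (R : realType) (x : R) : 0 < x ->
  x <= (`|(Num.ceil x - 1)%R|%N).+1%:R.
Proof.
move=> x_gt0; apply: (le_trans (ceil_ge x)).
have c_ge1 : 0 <= Num.ceil x - 1 by rewrite subr_ge0 -gtz0_ge1 ceil_gt0.
by rewrite -natr1 natr_absz ger0_norm// intrB subrK.
Qed.

Theorem theorem5p11 (R : realType) (t0 tf : R) (t0_lt_tf : t0 < tf)
    (W P : finType) (od : P -> W)
    (Psi : flow t0 tf P -> flow t0 tf P) (Psi_delay : delay_operator Psi)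
    (Theta : demand R W -> demand R W) (Theta_inv : inverse_demand Theta)
    (Lb : set (espace t0 tf P W))
    (Lb_feasible : Lb `<=` feasible od) (Lb_nonempty : Lb !=set0)
    (Lb_closed : closed Lb) (Lb_convex : convex_set Lb)
    (Lb_bounded : bounded_set Lb)
    (D : R) (D_diameter : D = diameter Lb) (D_gt0 : 0 < D)
    (Yd_nonempty : minty_solutions (vi_map Psi Theta) Lb !=set0)
    (a : R) (a_gt0 : 0 < a)
    (X : nat -> espace t0 tf P W)
    (X_proximal : proximal_sequence (vi_map Psi Theta) Lb a X)
    (mu : nat -> nat)
    (mu_argmin : forall k,
      argmin_upto (fun i => `|X i - X i.+1| ^+ 2) k (mu k))
    (delta : R) (delta_gt0 : 0 < delta) :
  let N := `|(Num.ceil (a ^+ 2 * D ^+ 4 / delta ^+ 2) - 1)%R|%N in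
  (forall Y, Lb Y ->
     - delta <= dot (vi_map Psi Theta (X (mu N).+1)) (Y - X (mu N).+1)) /\
  (forall k : nat,
     `|X k.+1 - X k| <= delta / (a * D) ->
     (forall j, (j < k)%N -> delta / (a * D) < `|X j.+1 - X j|) ->
     forall Y, Lb Y ->
       - delta <= dot (vi_map Psi Theta (X k.+1)) (Y - X k.+1)).
Proof.
move=> N; have [Z YZ] := Yd_nonempty; subst D.
split=> [|k step _]; last by move=> Y; exact: (gap_of_small_step a_gt0 Lb_bounded).
move=> Y; apply: (gap_of_small_step a_gt0 Lb_bounded X_proximal D_gt0).
set D := diameter Lb in D_gt0 N *; set i := mu N.
have aD_gt0 : 0 < a * D by rewrite mulr_gt0.
rewrite distrC -(@ler_pXn2r _ 2) ?nnegrE ?divr_ge0 ?(ltW aD_gt0) ?(ltW delta_gt0)//.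
have c_gt0 : 0 < a ^+ 2 * D ^+ 4 / delta ^+ 2.
  by rewrite divr_gt0 ?mulr_gt0 ?exprn_gt0.
(* This scaling turns the squared threshold into [D ^+ 2], the bound on the sum
   of the squared steps. *)
rewrite -(ler_pM2l c_gt0).
have -> : a ^+ 2 * D ^+ 4 / delta ^+ 2 * (delta / (a * D)) ^+ 2 = D ^+ 2.
  by field; rewrite !gt_eqF.
apply: le_trans (sum_steps_le_diameter a_gt0 Lb_bounded X_proximal N.+1 YZ).
apply: le_trans (argmin_upto_le_mean (mu_argmin N)).
by rewrite ler_wpM2r ?sqr_ge0// le_succ_absz_ceil.
Qed.
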